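(* Let $K=K(X,\mathcal M,\alpha,r)$ be the PoSI constant. For every (measurable) model selection procedure $\hat M:\mathbb R^n\to\mathcal M$, writing $\hat M=\hat M(Y)$, $$P\bigl[\exists\, j\in\hat M:\ \beta_{j\cdot\hat M}=0\ \text{ and }\ |t^{(0)}_{j\cdot\hat M}|>K\bigr]\ \le\ \alpha ,$$ where $t^{(0)}_{j\cdot M}$ is the $t$-statistic for the null hypothesis $\beta_{j\cdot M}=0$.
   Context: Setting. $X=(X_1,\dots,X_p)$ is a fixed real $n\times p$ matrix with $d=\operatorname{rank}(X)\ge 1$ ($n,p$ arbitrary). $Y\sim N(\mu,\sigma^2 I_n)$, where $\mu\in\mathbb R^n$ is arbitrary (not assumed to lie in the column space of $X$) and $\sigma>0$. $\hat\sigma>0$ is a random variable with $\hat\sigma^2\sim\sigma^2\chi^2_r/r$ ($r$ degrees of freedom; $r=\infty$ means $\hat\sigma=\sigma$), independent of all least squares estimates below. Submodels. For nonempty $M\subset\{1,\dots,p\}$, $X_M$ is the submatrix of columns indexed by $M$. $\mathcal M_{\mathrm{all}}=\{M: M\ne\varnothing,\ \operatorname{rank}(X_M)=|M|\}$. $\mathcal M$ is a fixed nonempty subset of $\mathcal M_{\mathrm{all}}$ with $\bigcup_{M\in\mathcal M}M=\{1,\dots,p\}$. For $M\in\mathcal M_{\mathrm{all}}$: $\hat\beta_M=(X_M^TX_M)^{-1}X_M^TY$ and $\beta_M=E[\hat\beta_M]=(X_M^TX_M)^{-1}X_M^T\mu$, with components $\hat\beta_{j\cdot M},\beta_{j\cdot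 M}$ indexed by $j\in M$. $X_{j\cdot M}$ ($j\in M$) is the residual vector of $X_j$ after orthogonal projection onto the span of $\{X_k:k\in M\setminus\{j\}\}$ (equal to $X_j$ if $M=\{j\}$). Define $$t_{j\cdot M}=\frac{\hat\beta_{j\cdot M}-\beta_{j\cdot M}}{\hat\sigma/\|X_{j\cdot M}\|},\qquad t^{(0)}_{j\cdot M}=\frac{\hat\beta_{j\cdot M}}{\hat\sigma/\|X_{j\cdot M}\|}.$$ PoSI constant. For $\alpha\in(0,1)$, $K(X,\mathcal M,\alpha,r)$ is the minimal $K$ with $P[\max_{M\in\mathcal M}\max_{j\in M}|t_{j\cdot M}|\le K]\ge1-\alpha$. *)

(* Defs.v *)
From HB Require Import structures.
From mathcomp Require Import all_boot all_order all_algebra.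
From mathcomp Require Import all_classical all_reals all_analysis.

Set Implicit Arguments.
Unset Strict Implicit.
Unset Printing Implicit Defensive.

Import Order.TTheory GRing.Theory Num.Theory.
Import numFieldNormedType.Exports.

Local Open Scope classical_set_scope.
Local Open Scope ring_scope.

Section SubmodelRegression.
Context {R : realType} {n p : nat}.
Implicit Types (X : 'M[R]_(n, p)) (M : {set 'I_p}) (j : 'I_p).
Implicit Types (y m : 'cV[R]_n) (s : R).

(* The columns of X indexed by M, in increasing order of their indices. *)
Definition subdesign X M : 'M[R]_(n, #|M|) :=
  colsub (fun k : 'I_#|M| => enum_val k) X.

Definition all_submodels X : {set {set 'I_p}} :=
  finset (fun M => (M != finset.set0) && (\rank (subdesign X M) == #|M|)).

(* With y the data this is the least squares estimate of the submodel M; with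
   y the mean of the data it is, by linearity, its expectation. *)
Definition lse X M y : 'cV[R]_#|M| :=
  invmx ((subdesign X M)^T *m subdesign X M) *m (subdesign X M)^T *m y.

(* The component belonging to the predictor j of a vector indexed by M
   (0 if j is not in M). *)
Definition component M (b : 'cV[R]_#|M|) j : R :=
  if [pick k : 'I_#|M| | enum_val k == j] is Some k then b k 0 else 0.

Definition coef X M j y : R := component (lse X M y) j.

(* Orthogonal projection onto the column span of A, for A of full column rank;
   it is 0 if A has no columns. *)
Definition proj_cols q (A : 'M[R]_(n, q)) : 'M[R]_n :=
  A *m invmx (A^T *m A) *m A^T.

Definition adjusted X M j : 'cV[R]_n :=
  col j X - proj_cols (subdesign X (finset.setD M (finset.set1 j))) *m col j X.

Definition enorm (v : 'cV[R]_n) : R := Num.sqrt (\sum_i v i 0 ^+ 2).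

(* y is the data, m the mean of the data, s the estimate of the standard
   deviation. *)
Definition tstat X M j m y s : R :=
  (coef X M j y - coef X M j m) / (s / enorm (adjusted X M j)).

Definition tstat0 X M j y s : R :=
  coef X M j y / (s / enorm (adjusted X M j)).

(* The arguments of the maxima are nonnegative, so that the default value 0 is
   harmless. *)
Definition max_abs_tstat X (MM : {set {set 'I_p}}) m y s : R :=
  \big[Num.max/0]_(M in MM) \big[Num.max/0]_(j in M) `|tstat X M j m y s|.

End SubmodelRegression.

Section ChiSquare.
Context {R : realType}.

Definition Gamma (a : R) : R :=
  (\int[@lebesgue_measure R]_(x in `]0%R, +oo[) (x `^ (a - 1) * expR (- x)))%R.

Definition chi2_pdf (k : nat) (x : R) : R :=
  if 0 < x then
    x `^ (k%:R / 2 - 1) * expR (- x / 2) / (2 `^ (k%:R / 2) * Gamma (k%:R / 2))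
  else 0.

Definition chi2_prob (k : nat) (B : set R) : \bar R :=
  (\int[@lebesgue_measure R]_(x in B) (chi2_pdf k x)%:E)%E.

End ChiSquare.

(* R^n with its product sigma-algebra is the measurable type of n-tuples. *)
Definition vec {R : realType} {n : nat} (y : n.-tuple R) : 'cV[R]_n :=
  \col_i tnth y i.

Section GaussianSetting.
Context {R : realType} {d : measure_display} {T : measurableType d}.
Context (P : probability T R) {n p : nat}.

(* Y ~ N(m, sigma^2 I_n): the law of Y is the product of the N(m_i, sigma^2). *)
Definition gaussian_law (m : 'cV[R]_n) (sigma : R) (Y : T -> n.-tuple R) :=
  forall B : 'I_n -> set R, (forall i, measurable (B i)) ->
    P [set w | forall i, B i (tnth (Y w) i)] =
    (\prod_(i < n) normal_prob (m i 0%R) sigma (B i))%E.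

(* The number of degrees of freedom is Some k, with k positive, or None for
   infinity. *)
Definition scale_law (r : option nat) (sigma : R) (s : T -> R) :=
  if r is Some k then
    (0 < k)%N /\
    forall B : set R, measurable B ->
      P [set w | B (k%:R * s w ^+ 2 / sigma ^+ 2)] = chi2_prob k B
  else forall w, s w = sigma.

(* The sigma-algebra on T generated by all the coefficients of the least squares
   estimates of all the submodels. *)
Definition lse_events (X : 'M[R]_(n, p)) (Y : T -> n.-tuple R) : set (set T) :=
  <<s [set A | exists M j (B : set R),
        [/\ M \in all_submodels X, j \in M, measurable B &
            A = [set w | B (coef X M j (vec (Y w)))]] ]>>.

Definition indep_of_lse (X : 'M[R]_(n, p)) (Y : T -> n.-tuple R) (s : T -> R) :=
  forall (A : set T) (B : set R), lse_events X Y A -> measurable B ->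
    P (A `&` s @^-1` B) = (P A * P (s @^-1` B))%E.

Definition gaussian_setting (X : 'M[R]_(n, p)) (r : option nat)
    (m : 'cV[R]_n) (sigma : R) (Y : {RV P >-> n.-tuple R}) (s : {RV P >-> R}) :=
  [/\ 0 < sigma, gaussian_law m sigma Y, forall w, 0 < s w,
      scale_law r sigma s & indep_of_lse X Y s].

End GaussianSetting.

Section PoSIConstant.
Context {R : realType} {n p : nat}.

(* K is the minimal bound of simultaneous coverage 1 - alpha, whatever the
   underlying probability space and the parameters m and sigma: the law of the
   maximum depends on X, MM and r only. *)
Definition is_posi_constant (X : 'M[R]_(n, p)) (MM : {set {set 'I_p}})
    (alpha : R) (r : option nat) (K : R) :=
  forall (d : measure_display) (T : measurableType d) (P : probability T R)
    (m : 'cV[R]_n) (sigma : R) (Y : {RV P >-> n.-tuple R}) (s : {RV P >-> R}),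
  gaussian_setting X r m sigma Y s ->
  let covers (C : R) := ((1 - alpha)%:E <=
    P [set w | (max_abs_tstat X MM m (vec (Y w)) (s w) <= C)%R])%E in
  covers K /\ forall C : R, covers C -> K <= C.

Definition posi_constant (X : 'M[R]_(n, p)) (MM : {set {set 'I_p}})
    (alpha : R) (r : option nat) : R :=
  xget 0 [set K | is_posi_constant X MM alpha r K].

End PoSIConstant.

(* Main.v *)
Require Import Defs.
From HB Require Import structures.
From mathcomp Require Import all_boot all_order all_algebra.
From mathcomp Require Import all_classical all_reals all_analysis.
From mathcomp Require Import measurable_realfun ring.
Import Order.TTheory GRing.Theory Num.Theory.
Import numFieldNormedType.Exports.
Local Open Scope classical_set_scope.
Local Open Scope ring_scope.

Set Implicit Arguments.
Unset Strict Implicit.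
Unset Printing Implicit Defensive.

(** The corollary needs two facts.

    The first is a comparison that holds at every sample point.  If the selected
    model contains a predictor j whose coefficient vanishes there, then the null
    statistic of j equals its centred statistic, and the latter is at most the
    maximum over all submodels and all their predictors.  So a false rejection
    at level K forces that maximum to exceed K, whatever the selection rule.

    The second is that the maximum exceeds the PoSI constant with probability at
    most alpha.  The constant is defined by a property required of all Gaussian
    settings at once, so one has to show that some real number has it; this is
    the bulk of the proof ([posi_constantP]).  In a single setting, the
    (1 - alpha)-quantile of the maximum is the least bound of coverage 1 - alpha:
    distribution functions are right continuous ([exists_quantile]).  Coverage
    is the same in all settings ([coverage_invariant]): dividing numerator and
    denominator by sigma shows that the maximum depends only on the
    pivot formed by s / sigma and the least squares coefficients of the noise
    (Y - m) / sigma.  The noise is standard normal ([gaussian_law_noise]), the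
    law of s / sigma depends only on the degrees of freedom ([scale_law_ratio]),
    and the two are independent, as the coefficients of the noise are affine
    functions of those of Y.  This determines the probabilities of boxes
    ([pivot_law]), and boxes determine a law on tuples ([eq_tuple_law]). *)

(** * Standardization of the normal law *)

Lemma measurable_fun_standardize (R : realType) (m sigma : R) :
  measurable_fun [set: R] (fun x : R => (x - m) / sigma).
Proof.
apply: measurable_funM => //.
exact: measurable_funB.
Qed.

(** Lebesgue measure is characterised by the lengths of intervals, and the affine
    map divides lengths by sigma. *)
Lemma lebesgue_measure_standardize (R : realType) (m sigma : R) (A : set R) :
  0 < sigma -> measurable A ->
  (sigma^-1%:E *
    lebesgue_measure ((fun x : R => (x - m) / sigma)%R @^-1` A) =
  lebesgue_measure A)%E.
Proof.
move=> s0 mA.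
pose g : R -> measurableTypeR R := fun x => (x - m) / sigma.
have mg : measurable_fun [set: R] (g : R -> measurableTypeR R).
  exact: measurable_fun_standardize.
have is0 : 0 <= sigma^-1 by rewrite invr_ge0 ltW.
(* [push] is a function of the measurability proof, on which the measure
   structure of the image measure depends. *)
pose push : {measure set (measurableTypeR R) -> \bar R} :=
  pushforward lebesgue_measure g.
transitivity (mscale (NngNum is0) (push mg) A) => //.
apply/esym/lebesgue_measure_unique => // _ [[a b]] _ <-.
transitivity (sigma^-1%:E * lebesgue_measure (g @^-1` `]a, b]%classic))%E => //.
have -> : g @^-1` `]a, b]%classic = `](a * sigma + m), (b * sigma + m)]%classic.
  apply/seteqP; split=> x /=; rewrite /g !in_itv /= ltr_pdivlMr// ler_pdivrMr//;
  by rewrite ltrBrDr lerBlDr.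
rewrite !lebesgue_measure_itv /= !lte_fin ltrD2r ltr_pM2r//.
case: ifPn => ab; last by rewrite mule0.
rewrite -!EFinD -EFinM; congr EFin.
field.
by rewrite gt_eqF.
Qed.

Lemma normal_pdf_standardize (R : realType) (m sigma x : R) : 0 < sigma ->
  normal_pdf m sigma x = sigma^-1 * normal_pdf 0 1 ((x - m) / sigma).
Proof.
move=> s0.
rewrite !normal_pdfE ?oner_eq0 ?gt_eqF// /normal_peak /normal_fun mulrA.
congr (_ * _).
  rewrite expr1n mul1r -mulrnAr sqrtrM ?sqr_ge0// sqrtr_sqr gtr0_norm//.
  by rewrite invfM.
congr expR.
rewrite subr0 expr1n; field.
by rewrite gt_eqF.
Qed.

(** The change of variables x |-> (x - m) / sigma: the factor 1 / sigma of the
    density is absorbed by the scaling of Lebesgue measure. *)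
Lemma normal_prob_standardize (R : realType) (m sigma : R) (B : set R) :
  0 < sigma -> measurable B ->
  normal_prob m sigma ((fun x => (x - m) / sigma) @^-1` B) = normal_prob 0 1 B.
Proof.
move=> s0 mB.
pose g : R -> measurableTypeR R := fun x => (x - m) / sigma.
have mg : measurable_fun [set: R] (g : R -> measurableTypeR R).
  exact: measurable_fun_standardize.
have is0 : 0 <= sigma^-1 by rewrite invr_ge0 ltW.
have mpdf : measurable_fun [set: R] (fun x : R => (normal_pdf 0 1 x)%:E).
  by apply/measurable_EFinP; exact: measurable_normal_pdf.
rewrite /normal_prob.
pose push : {measure set (measurableTypeR R) -> \bar R} :=
  pushforward lebesgue_measure g.
transitivity (\int[mscale (NngNum is0) (push mg)]_(x in B)
   (normal_pdf 0 1 x)%:E)%E; last first.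
  apply: eq_measure_integral => A mA AB.
  exact: lebesgue_measure_standardize.
have pdf0 (x : R) : (0 <= (normal_pdf 0 1 x)%:E)%E.
  by rewrite lee_fin normal_pdf_ge0.
have mpdfB := @measurable_funTS _ _ _ _ B _ mpdf.
rewrite ge0_integral_mscale//= ge0_integral_pushforward//=.
rewrite -ge0_integralZl//=.
- by apply: eq_integral => x _; rewrite normal_pdf_standardize.
- by rewrite -[X in measurable X]setTI; exact: mg.
- by apply: measurable_funTS; exact: (measurableT_comp mpdf).
Qed.

(** * Laws of random tuples *)

Definition box {R : realType} {n : nat} (B : 'I_n -> set R) : set (n.-tuple R) :=
  [set t | forall i, B i (tnth t i)].

Lemma measurable_box (R : realType) (n : nat) (B : 'I_n -> set R) :
  (forall i, measurable (B i)) -> measurable (box B).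
Proof.
move=> mB.
have -> : box B = \bigcap_(i in [set: 'I_n]) ((@tnth n R)^~ i @^-1` B i).
  by apply/seteqP; split=> [t tB i _|t tB i]; exact: tB.
apply: fin_bigcap_measurable => // i _.
by rewrite -[X in measurable X]setTI; exact: measurable_tnth.
Qed.

Lemma measurable_tuple_boxes (R : realType) (n : nat) :
  (@measurable _ (n.-tuple R)) =
  <<s [set A | exists2 B : 'I_n -> set R,
    (forall i, measurable (B i)) & A = box B] >>.
Proof.
apply/seteqP; split; last first.
  apply: smallest_sub; first exact: sigma_algebra_measurable.
  by move=> _ [B mB ->]; exact: measurable_box.
apply: smallest_sub; first exact: smallest_sigma_algebra.
move=> A; rewrite -bigcup_seq => -[i _ [B mB <-]].
apply: sub_sigma_algebra; exists (fun j => if j == i then B else setT).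
  by move=> j; case: ifP.
apply/seteqP; split=> [t [_ tB] j|t tB].
  by case: eqP => // ->.
by split=> //; have := tB i; rewrite eqxx.
Qed.

Section TupleLaws.
Context {R : realType} {n : nat}.
Context {d} {T : measurableType d} (P : probability T R).
Context {d'} {T' : measurableType d'} (P' : probability T' R).

(** Boxes are stable under intersection and generate the sigma-algebra, so that
    two probability measures that agree on boxes are equal. *)
Lemma eq_tuple_law (W : T -> n.-tuple R) (W' : T' -> n.-tuple R) :
  measurable_fun setT W -> measurable_fun setT W' ->
  (forall B : 'I_n -> set R, (forall i, measurable (B i)) ->
    P (W @^-1` box B) = P' (W' @^-1` box B)) ->
  forall A, measurable A -> P (W @^-1` A) = P' (W' @^-1` A).
Proof.
move=> mW mW' WW' A mA.
pose V : {mfun T >-> n.-tuple R} :=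
  HB.pack W (isMeasurableFun.Build _ _ _ _ _ mW).
pose V' : {mfun T' >-> n.-tuple R} :=
  HB.pack W' (isMeasurableFun.Build _ _ _ _ _ mW').
apply: (measure_unique [set A | exists2 B : 'I_n -> set R,
    (forall i, measurable (B i)) & A = box B] (fun=> setT)
    _ _ _ _ (distribution P V) (distribution P' V')) => //.
- exact: measurable_tuple_boxes.
- move=> _ _ [B mB ->] [C mC ->]; exists (fun i => B i `&` C i).
    by move=> i; exact: measurableI.
  apply/seteqP; split=> [t [tB tC] i|t tBC]; first by split.
  by split=> i; have [] := tBC i.
- move=> _; exists (fun=> setT) => //.
  by apply/seteqP; split.
- by rewrite bigcup_const.
- by move=> _ [B mB ->]; exact: WW'.
- by move=> _; rewrite (le_lt_trans (probability_le1 _ _)) ?ltry.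
Qed.

End TupleLaws.

(** * Noise and its least squares coefficients *)

Definition noise {R : realType} {n : nat} (m : 'cV[R]_n) (sigma : R)
    (y : n.-tuple R) : n.-tuple R :=
  [tuple (tnth y i - m i 0) / sigma | i < n].

Lemma vec_noise (R : realType) (n : nat) (m : 'cV[R]_n) (sigma : R)
    (y : n.-tuple R) : vec (noise m sigma y) = sigma^-1 *: (vec y - m).
Proof.
by apply/matrixP => i j; rewrite !mxE tnth_mktuple ord1 mulrC.
Qed.

Lemma measurable_noise (R : realType) (n : nat) (m : 'cV[R]_n) (sigma : R) :
  measurable_fun setT (noise m sigma).
Proof.
apply/measurable_fun_tnthP => i.
rewrite (_ : _ \o _ = (fun x => (x - m i 0) / sigma) \o (@tnth n R ^~ i)).
  apply: measurableT_comp; first exact: measurable_fun_standardize.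
  exact: measurable_tnth.
by apply/funext => y /=; rewrite tnth_mktuple.
Qed.

Lemma gaussian_law_noise (R : realType) (d : measure_display)
    (T : measurableType d) (P : probability T R) (n : nat) (m : 'cV[R]_n)
    (sigma : R) (Y : T -> n.-tuple R) (B : 'I_n -> set R) :
  0 < sigma -> gaussian_law P m sigma Y -> (forall i, measurable (B i)) ->
  P ((noise m sigma \o Y) @^-1` box B) = (\prod_(i < n) normal_prob 0 1 (B i))%E.
Proof.
move=> s0 gY mB.
pose C i : set R := (fun x => (x - m i 0) / sigma) @^-1` B i.
have mC i : measurable (C i).
  by rewrite -[X in measurable X]setTI; exact: measurable_fun_standardize.
rewrite (_ : _ @^-1` _ = [set w | forall i, C i (tnth (Y w) i)]); last first.
  by apply/seteqP; split=> w wB i; have := wB i; rewrite /C /= tnth_mktuple.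
by rewrite gY//; apply: eq_bigr => i _; exact: normal_prob_standardize.
Qed.

Lemma componentD (R : realType) (p : nat) (M : {set 'I_p}) (b c : 'cV[R]_#|M|) j :
  component (b + c) j = component b j + component c j.
Proof. by rewrite /component; case: pickP => [k _|]; rewrite ?mxE ?addr0. Qed.

Lemma componentZ (R : realType) (p : nat) (M : {set 'I_p}) (a : R)
    (b : 'cV[R]_#|M|) j :
  component (a *: b) j = a * component b j.
Proof. by rewrite /component; case: pickP => [k _|]; rewrite ?mxE ?mulr0. Qed.

Lemma coef_noise (R : realType) (n p : nat) (X : 'M[R]_(n, p)) M j
    (m : 'cV[R]_n) (sigma : R) (y : n.-tuple R) :
  coef X M j (vec (noise m sigma y)) =
  (coef X M j (vec y) - coef X M j m) / sigma.
Proof.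
rewrite vec_noise /coef /lse -scalemxAr componentZ mulmxBr componentD mulrC.
by rewrite -scaleN1r componentZ mulN1r.
Qed.

Lemma measurable_coef (R : realType) (n p : nat) (X : 'M[R]_(n, p)) M j :
  measurable_fun setT (fun y : n.-tuple R => coef X M j (vec y)).
Proof.
rewrite /coef /component; case: pickP => [k _|_]; last exact: measurable_cst.
rewrite /lse; set A := _ *m _.
rewrite (_ : (fun y => _) = (fun y => \sum_i A k i * tnth y i)); last first.
  apply/funext => y; rewrite mxE; apply: eq_bigr => i _.
  by rewrite [X in _ * X]mxE.
apply: measurable_sum => i; apply: measurable_funM => //.
exact: measurable_tnth.
Qed.

(** * Measurability of inverses and maxima *)

(** The identity x^-1 = x * (x^2)^-1 holds at 0 too and reduces the inverse to a
    real power of a nonnegative number. *)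
Lemma measurable_inv (R : realType) : measurable_fun setT (@GRing.inv R).
Proof.
rewrite (_ : @GRing.inv R = (fun x => x * (x ^+ 2) `^ (-1))); last first.
  apply/funext => x; rewrite powR_inv1 ?sqr_ge0//.
  have [->|x0] := eqVneq x 0; first by rewrite mul0r invr0.
  by rewrite expr2 invfM mulrA divff// mul1r.
apply: measurable_funM => //.
exact: (measurableT_comp (measurable_powR (-1))).
Qed.

Lemma measurable_bigmax (R : realType) (d : measure_display)
    (T : measurableType d) (I : Type) (l : seq I) (Q : pred I) (a : R)
    (f : I -> T -> R) :
  (forall i, measurable_fun setT (f i)) ->
  measurable_fun setT (fun x => \big[Num.max/a]_(i <- l | Q i) f i x).
Proof.
move=> mf; elim: l => [|i l IHl].
  by under eq_fun do rewrite big_nil; exact: measurable_cst.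
under eq_fun do rewrite big_cons.
by case: (Q i) => //; exact: measurable_maxr.
Qed.

(** * Quantiles *)

(** The quantile is the infimum of the bounds of probability at least q; right
    continuity of the distribution function shows that it is attained. *)
Lemma exists_quantile (R : realType) (d : measure_display)
    (T : measurableType d) (P : probability T R) (Z : {RV P >-> R}) (q : R) :
  0 < q < 1 ->
  exists K : R, (q%:E <= cdf Z K)%E /\
    forall C : R, (q%:E <= cdf Z C)%E -> K <= C.
Proof.
move=> /andP[q0 q1].
pose S := [set C : R | (q%:E <= cdf Z C)%E].
rewrite -!lte_fin in q0 q1.
have [b qb] : exists b, (q%:E < cdf Z b)%E.
  exact: (@filter_ex _ (pinfty_nbhs R) _ _
    (@cvg_cdfy1 _ _ _ P Z _ (open_ereal_gt' q1))).
have [a aq] : exists a, (cdf Z a < q%:E)%E.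
  exact: (@filter_ex _ (ninfty_nbhs R) _ _
    (@cvg_cdfNy0 _ _ _ P Z _ (open_ereal_lt' q0))).
have lbS : lbound S a.
  move=> C SC; rewrite leNgt; apply/negP => Ca.
  have := lt_le_trans aq SC; rewrite ltNge => /negP; apply.
  by apply: cdf_nondecreasing; exact: ltW.
have iS : has_inf S by split; [exists b; exact: ltW|exists a].
exists (inf S); split; last by move=> C SC; exact: (ge_inf (proj2 iS) SC).
apply: (cvge_ge _ (@cdf_right_continuous _ _ _ P Z (inf S))).
near=> x.
have [C SC Cx] : exists2 C, S C & C < x.
  by apply: inf_lt; [exact: (proj1 iS)|near: x; exact: nbhs_right_gt].
by apply: (le_trans SC); apply: cdf_nondecreasing; exact: ltW.
Unshelve. all: by end_near.
Qed.

(** * The law of the relative error of the scale *)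

(** The law of s / sigma: that of sqrt (x / k) for x chi-squared with k degrees of
    freedom, or the point mass at 1 in the case of a known variance. *)
Definition scale_prob {R : realType} (r : option nat) (B : set R) : \bar R :=
  if r is Some k then chi2_prob k ((fun x => Num.sqrt (x / k%:R)) @^-1` B)
  else \d_(1 : R) B.

Lemma scale_law_ratio (R : realType) (d : measure_display)
    (T : measurableType d) (P : probability T R) (r : option nat) (sigma : R)
    (s : T -> R) (B : set R) :
  0 < sigma -> (forall w, 0 < s w) -> scale_law P r sigma s -> measurable B ->
  P [set w | B (s w / sigma)] = scale_prob r B.
Proof.
move=> s0 pos; case: r => [k|] /=.
  move=> [k0 law] mB.
  rewrite -law; last first.
    rewrite -[X in measurable X]setTI.
    apply: (@measurableT_comp _ _ _ _ _ _ (@Num.sqrt R)) => //.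
      by apply: continuous_measurable_fun; exact: sqrt_continuous.
    exact: measurable_funM.
  have sE w : Num.sqrt (k%:R * s w ^+ 2 / sigma ^+ 2 / k%:R) = s w / sigma.
    rewrite (_ : _ / k%:R = (s w / sigma) ^+ 2).
      by rewrite sqrtr_sqr ger0_norm// ltW// divr_gt0.
    by field; rewrite pnatr_eq0 -lt0n k0 gt_eqF.
  by congr (P _); apply/seteqP; split=> w /=; rewrite sE.
move=> sE mB.
rewrite (_ : [set w | _] = if 1 \in B then setT else set0).
  rewrite diracE; case: (1 \in B); first exact: probability_setT.
  exact: measure0.
apply/seteqP; split=> w /=; rewrite sE divff ?gt_eqF//.
  by move/mem_set => ->.
by case: ifP => // /set_mem.
Qed.

(** * The pivot *)

Definition regressors {p : nat} (MM : {set {set 'I_p}}) :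
    {set {set 'I_p} * 'I_p} :=
  finset (fun q => (q.1 \in MM) && (q.2 \in q.1)).

Section Pivot.
Context {R : realType} {n p : nat} (X : 'M[R]_(n, p)) (MM : {set {set 'I_p}}).

Definition coefs (y : n.-tuple R) : #|regressors MM|.-tuple R :=
  [tuple coef X (enum_val k).1 (enum_val k).2 (vec y) | k < #|regressors MM|].

Definition pivot (m : 'cV[R]_n) (sigma : R) (y : n.-tuple R) (s : R) :
    #|regressors MM|.+1.-tuple R :=
  [the _.+1.-tuple R of s / sigma :: coefs (noise m sigma y)].

(** The pivots for which the maximum is at most C.  The condition 0 <= C accounts
    for the default value 0 of the maxima. *)
Definition acceptance (C : R) : set (#|regressors MM|.+1.-tuple R) :=
  [set t | 0 <= C /\ forall k : 'I_#|regressors MM|,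
    `|tnth t (lift ord0 k) /
      (tnth t ord0 / enorm (adjusted X (enum_val k).1 (enum_val k).2))| <= C].

Lemma measurable_coefs : measurable_fun setT coefs.
Proof.
apply/measurable_fun_tnthP => k.
rewrite (_ : _ \o _ =
  fun y => coef X (enum_val k).1 (enum_val k).2 (vec y)).
  exact: measurable_coef.
by apply/funext => y /=; rewrite tnth_mktuple.
Qed.

Lemma measurable_acceptance C : measurable (acceptance C).
Proof.
have [C0|C0] := leP 0 C; last first.
  rewrite (_ : acceptance C = set0) //.
  by apply/seteqP; split=> // t [C0' _]; move: (lt_le_trans C0 C0'); rewrite ltxx.
rewrite (_ : acceptance C = \bigcap_(k in [set: 'I_#|regressors MM|])
  ((fun t : #|regressors MM|.+1.-tuple R => `|tnth t (lift ord0 k) /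
      (tnth t ord0 / enorm (adjusted X (enum_val k).1 (enum_val k).2))|)
    @^-1` `]-oo, C])); last first.
  apply/seteqP; split=> [t [_ tC] k _|t tC].
    by rewrite /= in_itv /=; exact: tC.
  by split=> // k; have := tC k I; rewrite /= in_itv.
apply: fin_bigcap_measurable => // k _.
rewrite -[X in measurable X]setTI.
suff : measurable_fun setT (fun t : #|regressors MM|.+1.-tuple R =>
    `|tnth t (lift ord0 k) /
      (tnth t ord0 / enorm (adjusted X (enum_val k).1 (enum_val k).2))|).
  by apply => //; exact: measurable_itv.
apply: measurableT_comp => //; apply: measurable_funM.
  exact: measurable_tnth.
apply: (measurableT_comp (@measurable_inv R)); apply: measurable_funM => //.
exact: measurable_tnth.
Qed.

(** Dividing the numerator and the denominator of a t-statistic by sigma turns it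
    into a function of the pivot. *)
Lemma max_abs_tstat_le_pivot (m : 'cV[R]_n) (sigma : R) (y : n.-tuple R)
    (s C : R) : 0 < sigma ->
  (max_abs_tstat X MM m (vec y) s <= C) <-> acceptance C (pivot m sigma y s).
Proof.
move=> s0.
have tE M j e : (coef X M j (vec (noise m sigma y))) / (s / sigma / e) =
    (coef X M j (vec y) - coef X M j m) / (s / e).
  (* For s = 0 both sides are quotients by 0, hence 0. *)
  have [->|sn0] := eqVneq s 0; first by rewrite !(mul0r, invr0, mulr0).
  by rewrite coef_noise !invfM !invrK; field; rewrite sn0 gt_eqF.
split.
  move=> /bigmax_leP[C0 tC]; split=> // k.
  have := enum_valP k; rewrite inE => /andP[MMM jM].
  rewrite tnthS tnth0 tnth_mktuple tE.
  by have /bigmax_leP[_ /(_ _ jM)] := tC _ MMM.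
move=> [C0 tC]; apply/bigmax_leP; split=> // M MMM.
apply/bigmax_leP; split=> // j jM.
have MjMM : (M, j) \in regressors MM by rewrite inE MMM.
have := tC (enum_rank_in MjMM (M, j)).
by rewrite tnthS tnth0 tnth_mktuple tE enum_rankK_in.
Qed.

Lemma max_abs_tstat_ge (m y : 'cV[R]_n) (s : R) M j : M \in MM -> j \in M ->
  `|tstat X M j m y s| <= max_abs_tstat X MM m y s.
Proof.
move=> MMM jM.
have /bigmax_leP[_ /(_ _ MMM)/bigmax_leP[_]] :=
  lexx (max_abs_tstat X MM m y s).
exact.
Qed.

End Pivot.
Arguments acceptance {R n p} X MM C.

(** * The law of the pivot *)

Section PivotLaw.
Context {R : realType} {n p : nat} (X : 'M[R]_(n, p)) (MM : {set {set 'I_p}}).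
Hypothesis hMM : MM \subset all_submodels X.
Context {d} {T : measurableType d} (P : probability T R).
Context (r : option nat) (m : 'cV[R]_n) (sigma : R).
Context (Y : {RV P >-> n.-tuple R}) (s : {RV P >-> R}).
Hypothesis hmodel : gaussian_setting X r m sigma Y s.

Lemma measurable_pivot :
  measurable_fun setT (fun w => pivot X MM m sigma (Y w) (s w)).
Proof.
apply: measurable_cons; first by exact: measurable_funM.
apply: (measurableT_comp (@measurable_coefs _ _ _ X MM)).
apply: (measurableT_comp (@measurable_noise _ _ m sigma)).
exact: measurable_funPT.
Qed.

(** Independence of the scale is known for the events generated by the
    coefficients of Y only; those of the noise are affine functions of them. *)
Lemma coefs_noise_event (B : 'I_#|regressors MM| -> set R) :
  (forall k, measurable (B k)) ->
  lse_events X Y [set w | box B (coefs X MM (noise m sigma (Y w)))].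
Proof.
move=> mB.
rewrite (_ : [set w | _] = \bigcap_(k in [set: 'I_#|regressors MM|])
  [set w | ((fun x => (x - coef X (enum_val k).1 (enum_val k).2 m) / sigma)
     @^-1` B k) (coef X (enum_val k).1 (enum_val k).2 (vec (Y w)))]); last first.
  apply/seteqP; split=> [w wB k _|w wB k].
    by have := wB k; rewrite tnth_mktuple coef_noise.
  by rewrite tnth_mktuple coef_noise; exact: wB.
apply: (@fin_bigcap_measurable _ (g_sigma_algebraType _)) => // k _.
apply: sub_sigma_algebra.
have := enum_valP k; rewrite inE => /andP[MMM jM].
exists (enum_val k).1, (enum_val k).2; eexists; split; last by [].
- exact: (fintype.subsetP hMM _ MMM).
- by [].
- by rewrite -[X in measurable X]setTI; exact: measurable_fun_standardize.
Qed.

Lemma pivot_law (B : 'I_#|regressors MM|.+1 -> set R) :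
  (forall i, measurable (B i)) ->
  P ((fun w => pivot X MM m sigma (Y w) (s w)) @^-1` box B) =
  (P ((noise m sigma \o Y) @^-1`
      (coefs X MM @^-1` box (fun k => B (lift ord0 k)))) *
   scale_prob r (B ord0))%E.
Proof.
move=> mB; have [s0 _ spos slaw indep] := hmodel.
rewrite -(scale_law_ratio s0 spos slaw)//.
rewrite -(indep _ ((fun x => x / sigma) @^-1` B ord0)).
- congr (P _); apply/seteqP; split=> w.
    move=> wB; split=> [k|].
      by have := wB (lift ord0 k); rewrite tnthS.
    by have := wB ord0; rewrite tnth0.
  move=> [wB wB0] i; case: (unliftP ord0 i) => [k ->|->].
    by rewrite tnthS; exact: wB.
  by rewrite tnth0.
- by apply: coefs_noise_event => k; exact: mB.
- rewrite -[X in measurable X]setTI.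
  suff : measurable_fun setT (fun x : R => x / sigma) by apply.
  exact: measurable_funM.
Qed.

Lemma coverage_pivot (C : R) :
  P [set w | max_abs_tstat X MM m (vec (Y w)) (s w) <= C] =
  P ((fun w => pivot X MM m sigma (Y w) (s w)) @^-1` acceptance X MM C).
Proof.
have [s0 _ _ _ _] := hmodel.
congr (P _); apply/seteqP.
split=> w /=;
  by have [] := @max_abs_tstat_le_pivot _ _ _ X MM m sigma (Y w) (s w) C s0.
Qed.

Lemma measurable_max_abs_tstat :
  measurable_fun setT (fun w => max_abs_tstat X MM m (vec (Y w)) (s w)).
Proof.
apply: measurable_bigmax => M; apply: measurable_bigmax => j.
rewrite /tstat; apply: measurableT_comp => //; apply: measurable_funM.
  apply: measurable_funB => //.
  exact: (measurableT_comp (@measurable_coef _ _ _ X M j)).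
by apply: (measurableT_comp (@measurable_inv R)); exact: measurable_funM.
Qed.

Lemma exists_coverage_quantile (alpha : R) : 0 < alpha < 1 ->
  let covers (C : R) := ((1 - alpha)%:E <=
    P [set w | (max_abs_tstat X MM m (vec (Y w)) (s w) <= C)%R])%E in
  exists K : R, covers K /\ forall C : R, covers C -> K <= C.
Proof.
move=> /andP[a0 a1] covers.
pose Z : {RV P >-> R} :=
  HB.pack (fun w => max_abs_tstat X MM m (vec (Y w)) (s w))
    (isMeasurableFun.Build _ _ _ _ _ measurable_max_abs_tstat).
have coversE C : covers C = ((1 - alpha)%:E <= cdf Z C)%E.
  rewrite /covers /cdf /distribution /pushforward.
  by congr (_ <= P _)%E; apply/seteqP; split=> w; rewrite /= in_itv.
have [|K [KC Kmin]] := @exists_quantile _ _ _ P Z (1 - alpha).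
  by apply/andP; split; [rewrite subr_gt0|rewrite ltrBlDr ltrDl].
by exists K; split=> [|C]; rewrite coversE//; exact: Kmin.
Qed.

End PivotLaw.

(** * The PoSI constant *)

(** The same law of the pivot arises whatever the probability space, the mean and
    sigma: its probability on a box is a standard Gaussian probability times a
    probability that depends only on r. *)
Lemma coverage_invariant (R : realType) (n p : nat) (X : 'M[R]_(n, p))
    (MM : {set {set 'I_p}}) (r : option nat)
    (d : measure_display) (T : measurableType d) (P : probability T R)
    (m : 'cV[R]_n) (sigma : R) (Y : {RV P >-> n.-tuple R}) (s : {RV P >-> R})
    (d' : measure_display) (T' : measurableType d') (P' : probability T' R)
    (m' : 'cV[R]_n) (sigma' : R)
    (Y' : {RV P' >-> n.-tuple R}) (s' : {RV P' >-> R}) (C : R) :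
  MM \subset all_submodels X ->
  gaussian_setting X r m sigma Y s -> gaussian_setting X r m' sigma' Y' s' ->
  P [set w | max_abs_tstat X MM m (vec (Y w)) (s w) <= C] =
  P' [set w | max_abs_tstat X MM m' (vec (Y' w)) (s' w) <= C].
Proof.
move=> hMM hmodel hmodel'.
rewrite (coverage_pivot _ hmodel) (coverage_pivot _ hmodel').
apply: eq_tuple_law; last exact: measurable_acceptance.
- exact: measurable_pivot.
- exact: measurable_pivot.
move=> B mB; rewrite (pivot_law hMM hmodel)// (pivot_law hMM hmodel')//.
congr (_ * _)%E.
have mnoise d0 (T0 : measurableType d0) (Q : probability T0 R) m0 sigma0
    (Y0 : {RV Q >-> n.-tuple R}) : measurable_fun setT (noise m0 sigma0 \o Y0).
  exact: (measurableT_comp (@measurable_noise _ _ m0 sigma0)).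
(* The event about the coefficients is not a box in the space of the noise, so
   that the uniqueness of laws is needed there a second time. *)
apply: eq_tuple_law => //.
  move=> A mA; have [s0 glaw _ _ _] := hmodel; have [s0' glaw' _ _ _] := hmodel'.
  by rewrite (gaussian_law_noise s0 glaw)// (gaussian_law_noise s0' glaw').
rewrite -[X in measurable X]setTI.
by apply: measurable_coefs => //; apply: measurable_box => k; exact: mB.
Qed.

(** A quantile of the maximum in one setting is a quantile in all of them, so the
    choice made in [posi_constant] is that of a number with the required
    property.  The given setting serves to produce such a quantile. *)
Lemma posi_constantP (R : realType) (n p : nat) (X : 'M[R]_(n, p))
    (MM : {set {set 'I_p}}) (alpha : R) (r : option nat)
    (d : measure_display) (T : measurableType d) (P : probability T R)
    (m : 'cV[R]_n) (sigma : R) (Y : {RV P >-> n.-tuple R}) (s : {RV P >-> R}) :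
  MM \subset all_submodels X -> 0 < alpha < 1 ->
  gaussian_setting X r m sigma Y s ->
  is_posi_constant X MM alpha r (posi_constant X MM alpha r).
Proof.
move=> hMM halpha hmodel; apply: (@xgetPex _ 0).
have [K [KC Kmin]] := exists_coverage_quantile X MM m Y s halpha.
exists K => d' T' P' m' sigma' Y' s' hmodel' covers.
have coversE C : covers C = ((1 - alpha)%:E <=
    P [set w | (max_abs_tstat X MM m (vec (Y w)) (s w) <= C)%R])%E.
  by rewrite /covers (coverage_invariant C hMM hmodel hmodel').
by split=> [|C]; rewrite coversE//; exact: Kmin.
Qed.

Unset Implicit Arguments.

Theorem corollary4p2 (R : realType) (n p : nat) (X : 'M[R]_(n, p))
    (hX : (1 <= \rank X)%N)
    (MM : {set {set 'I_p}})
    (hMM0 : exists M : {set 'I_p}, M \in MM)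
    (hMM : MM \subset all_submodels X)
    (hMMcover : forall j : 'I_p, exists2 M : {set 'I_p}, M \in MM & j \in M)
    (alpha : R) (halpha : 0 < alpha < 1) (r : option nat)
    (d : measure_display) (T : measurableType d) (P : probability T R)
    (m : 'cV[R]_n) (sigma : R) (Y : {RV P >-> n.-tuple R}) (s : {RV P >-> R})
    (hmodel : gaussian_setting X r m sigma Y s)
    (Mhat : n.-tuple R -> {set 'I_p})
    (hMhat : forall y, Mhat y \in MM)
    (hMhat_meas : forall M : {set 'I_p}, measurable (Mhat @^-1` [set M])) :
  (P [set w | exists j : 'I_p,
        [/\ j \in Mhat (Y w),
            coef X (Mhat (Y w)) j m = 0%R &
            (posi_constant X MM alpha r <
              `|tstat0 X (Mhat (Y w)) j (vec (Y w)) (s w)|)%R] ]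
   <= alpha%:E)%E.
Proof.
set K := posi_constant X MM alpha r.
have [KC _] := posi_constantP hMM halpha hmodel hmodel.
pose F : set T := [set w | max_abs_tstat X MM m (vec (Y w)) (s w) <= K].
have mF : measurable F.
  rewrite (_ : F = (fun w => max_abs_tstat X MM m (vec (Y w)) (s w)) @^-1`
    `]-oo, K]); last by apply/seteqP; split=> w; rewrite /F /= in_itv.
  rewrite -[X in measurable X]setTI.
  by apply: (measurable_max_abs_tstat X MM m Y s) => //; exact: measurable_itv.
have PFC : (P (~` F) <= alpha%:E)%E.
  rewrite probability_setC// leeBlDr ?fin_num_measure// addeC -leeBlDr//.
apply: le_trans PFC; apply: le_measure; rewrite ?inE.
- (* The rejection event is a finite union over the values of the selected
     model and of the predictor. *)
  rewrite (_ : [set w | _] = \bigcup_(q in [set: {set 'I_p} * 'I_p])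
    ([set w | Mhat (Y w) = q.1] `&` [set w | [/\ q.2 \in q.1,
       coef X q.1 q.2 m = 0 &
       (K < `|tstat0 X q.1 q.2 (vec (Y w)) (s w)|)%R]])); last first.
    apply/seteqP; split=> w.
      by move=> [j [jM cj Kj]]; exists (Mhat (Y w), j).
    by move=> [[M j] _ [/= -> [jM cj Kj]]]; exists j.
  apply: fin_bigcup_measurable => // -[M j] _ /=; apply: measurableI.
    rewrite (_ : [set w | _] = Y @^-1` (Mhat @^-1` [set M]))//.
    exact: measurable_funPTI.
  have mt : measurable_fun setT (fun w => `|tstat0 X M j (vec (Y w)) (s w)|).
    apply: measurableT_comp => //; apply: measurable_funM.
      exact: (measurableT_comp (@measurable_coef _ _ _ X M j)).
    by apply: (measurableT_comp (@measurable_inv R)); exact: measurable_funM.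
  have [/andP[jM /eqP cj]|Mj] := boolP ((j \in M) && (coef X M j m == 0)).
    rewrite (_ : [set w | _] =
      (fun w => `|tstat0 X M j (vec (Y w)) (s w)|) @^-1` `]K, +oo[).
      by rewrite -[X in measurable X]setTI; apply: mt => //;
        exact: measurable_itv.
    by apply/seteqP; split=> w; rewrite /= in_itv /= andbT; [case|split].
  rewrite (_ : [set w | _] = set0)//; apply/seteqP; split=> // w [jM cj _].
  by rewrite jM cj eqxx in Mj.
- exact: measurableC.
(* With a vanishing true coefficient, the null statistic is the centred one. *)
move=> w [j [jM cj Kj]] wF; move: Kj; rewrite ltNge => /negP; apply.
apply: le_trans wF.
have := max_abs_tstat_ge X m (vec (Y w)) (s w) (hMhat (Y w)) jM.
by rewrite /tstat cj subr0.
Qed.
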